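(* Every pattern $P\subset 2\mathbb{N}_0+1$ (that is, every set $P$ of odd positive integers) is positive definite completable.
   Context: $\mathbb{N}_0=\{0,1,2,\dots\}$. For a real sequence $\{s_k\}_{k\in\mathbb{N}_0}$ let $H_n=[s_{i+j}]_{i,j=0}^{n}$ be its Hankel matrices, $n\in\mathbb{N}_0$. The sequence is positive if $H_n$ is positive semidefinite for all $n$; it is a positive definite sequence if $H_n$ is positive definite for all $n$; it is a positive semidefinite sequence if it is positive but not positive definite. A partial sequence is a sequence $\{s_k\}_{k\in\mathbb{N}_0}$ in which some terms are specified real numbers while the remaining terms are unspecified (free real variables). Its pattern is $P=\{k\in\mathbb{N}_0 : s_k \text{ is specified}\}$. A partial sequence is partial positive definite if, for every $n\in\mathbb{N}_0$, each fully specified principal submatrix of $H_n$ is positive definite. A positive completion (Hamburger moment completion) of a partial sequence is a choice of real values for the unspecified terms such that the resulting sequence is positive definite or positive semidefinite (i.e. positive). A pattern $P$ is positive definite completable if every partial positive definite sequence with pattern $P$ has a positive completion. *)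

(* Defs.v *)
From mathcomp Require Import all_boot all_order all_algebra.
From mathcomp Require Import boolp classical_sets reals.

Set Implicit Arguments.
Unset Strict Implicit.
Unset Printing Implicit Defensive.

Import Order.TTheory GRing.Theory Num.Theory.

Local Open Scope classical_set_scope.
Local Open Scope ring_scope.

Definition posdefmx (R : realType) (n : nat) (A : 'M[R]_n) : Prop :=
  A \is symmetricmx /\ forall v : 'rV[R]_n, v != 0 -> 0 < (v *m A *m v^T) 0 0.

Definition possemidefmx (R : realType) (n : nat) (A : 'M[R]_n) : Prop :=
  A \is symmetricmx /\ forall v : 'rV[R]_n, 0 <= (v *m A *m v^T) 0 0.

(* [H_n] has size n+1; [T] is [R] for a sequence and [option R] for a partial
   sequence. *)
Definition hankel (T : Type) (s : nat -> T) (n : nat) : 'M[T]_n.+1 :=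
  \matrix_(i, j) s (i + j)%N.

Definition positive_seq (R : realType) (s : nat -> R) : Prop :=
  forall n : nat, possemidefmx (hankel s n).

Definition posdef_seq (R : realType) (s : nat -> R) : Prop :=
  forall n : nat, posdefmx (hankel s n).

Definition possemidef_seq (R : realType) (s : nat -> R) : Prop :=
  positive_seq s /\ ~ posdef_seq s.

(* In a partial sequence [s : nat -> option R], [s k = None] means that the
   k-th term is unspecified. *)
Definition pattern (R : realType) (s : nat -> option R) : set nat :=
  [set k | isSome (s k)].

Definition principal_submx (T : Type) (n : nat) (A : {set 'I_n})
    (M : 'M[T]_n) : 'M[T]_#|A| :=
  mxsub (@enum_val _ (mem A)) (@enum_val _ (mem A)) M.

(* The principal submatrix on [A] is fully specified exactly when it is
   [map_mx Some B] for a (then unique) real matrix [B]. *)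
Definition partial_posdef (R : realType) (s : nat -> option R) : Prop :=
  forall (n : nat) (A : {set 'I_n.+1}) (B : 'M[R]_#|A|),
    principal_submx A (hankel s n) = map_mx Some B -> posdefmx B.

Definition completes (R : realType) (s : nat -> option R) (t : nat -> R) :
    Prop :=
  forall (k : nat) (x : R), s k = Some x -> t k = x.

Definition positive_completion (R : realType) (s : nat -> option R)
    (t : nat -> R) : Prop :=
  completes s t /\ (posdef_seq t \/ possemidef_seq t).

Definition posdef_completable (R : realType) (P : set nat) : Prop :=
  forall s : nat -> option R, pattern s = P -> partial_posdef s ->
    exists t : nat -> R, positive_completion s t.

(* Main.v *)
(** In [H_n] the last row and column involve only terms of index below [2n],
    except for the corner [s_(2n)].  Hence, with all the odd terms prescribed,
    the even terms can be chosen one after the other, each so large that the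
    quadratic form of [H_n] stays above [2^-(n+1)] times the squared norm. *)

Require Import Defs.
From mathcomp Require Import all_boot all_order all_algebra ring lra zify.
From mathcomp Require Import boolp classical_sets reals.

Import Order.TTheory GRing.Theory Num.Theory.

Local Open Scope classical_set_scope.
Local Open Scope ring_scope.

Lemma hankel_form_sum (R : realType) (t : nat -> R) (n : nat)
    (v : 'rV[R]_n.+1) :
  (v *m hankel t n *m v^T) 0 0 =
  \sum_(i < n.+1) \sum_(j < n.+1) v 0 i * v 0 j * t (i + j)%N.
Proof.
rewrite mxE exchange_big; apply: eq_bigr => j _ /=.
rewrite !mxE mulr_suml; apply: eq_bigr => i _.
by rewrite mxE; ring.
Qed.

(** Induction on [n]: half of the weight [2 ^- n] survives as [2 ^- n.+1], the other half absorbs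
    the cross terms with the new coordinate. With [v] on all of [nat], no vector has to be
    truncated. *)
Lemma hankel_form_lower_bound (R : realType) (t : nat -> R)
    (ht : forall n, 1 + \sum_(i < n) 2 ^+ n.+1 * t (n + i)%N ^+ 2
                    <= t (2 * n)%N)
    (v : nat -> R) (n : nat) :
  2 ^- n * \sum_(i < n) v i ^+ 2 <=
  \sum_(i < n) \sum_(j < n) v i * v j * t (i + j)%N.
Proof.
elim: n => [|n IHn]; first by rewrite !big_ord0 mulr0.
have -> : \sum_(i < n.+1) \sum_(j < n.+1) v i * v j * t (i + j)%N =
    \sum_(i < n) \sum_(j < n) v i * v j * t (i + j)%N +
    \sum_(i < n) 2 * v i * v n * t (n + i)%N + v n ^+ 2 * t (2 * n)%N.
  rewrite big_ord_recr /= [X in _ + X]big_ord_recr /= addrA mul2n addnn.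
  rewrite -expr2; congr (_ + _).
  under eq_bigr do rewrite big_ord_recr /=.
  rewrite big_split /= -addrA -big_split /=; congr (_ + _).
  by apply: eq_bigr => i _; rewrite addnC; ring.
rewrite big_ord_recr /= mulrDr.
have c0 : 0 < 2 ^+ n.+1 :> R by rewrite exprn_gt0.
have c1 : 2 ^- n.+1 <= 1 :> R.
  by rewrite invf_le1// exprn_ege1// ler1n.
(* Completing the square: each cross term costs [2 ^+ n.+1 * t (n + i) ^+ 2] times [v n ^+ 2], which
   is what the sum in [ht] provides. *)
have cross : 0 <= \sum_(i < n) (2 ^- n.+1 * v i ^+ 2
    + 2 * v i * v n * t (n + i)%N
    + v n ^+ 2 * (2 ^+ n.+1 * t (n + i)%N ^+ 2)).
  apply: sumr_ge0 => i _.
  have -> : 2 ^- n.+1 * v i ^+ 2 + 2 * v i * v n * t (n + i)%N +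
      v n ^+ 2 * (2 ^+ n.+1 * t (n + i)%N ^+ 2) =
      2 ^- n.+1 * (v i + 2 ^+ n.+1 * v n * t (n + i)%N) ^+ 2.
    by move: c0; set c := 2 ^+ n.+1 => c0; field; rewrite gt_eqF.
  by rewrite mulr_ge0 ?sqr_ge0// invr_ge0 ltW.
move: cross; rewrite !big_split /= -!mulr_sumr => cross.
have half : 2 ^- n = 2 * 2 ^- n.+1 :> R.
  by rewrite exprS invfM mulrA divff ?mul1r ?pnatr_eq0.
(* The summand 1 in [ht] is left over and covers the weight [2 ^- n.+1] of [v n ^+ 2]. *)
have corner := ler_wpM2l (sqr_ge0 (v n)) (ht n).
have last := ler_wpM2r (sqr_ge0 (v n)) c1.
move: IHn cross corner last; rewrite half -mulr_sumr.
by nra.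
Qed.

Lemma posdef_seq_of_growth (R : realType) (t : nat -> R)
    (ht : forall n, 1 + \sum_(i < n) 2 ^+ n.+1 * t (n + i)%N ^+ 2
                    <= t (2 * n)%N) :
  posdef_seq t.
Proof.
move=> n; split.
  apply/is_hermitianmxP; apply/matrixP => i j.
  by rewrite !mxE expr0 mul1r addnC.
move=> v v0; rewrite hankel_form_sum.
have /= := @hankel_form_lower_bound R t ht (fun k => v 0 (inord k)) n.+1.
under eq_bigr do rewrite inord_val.
under [X in _ <= X]eq_bigr do
  (under eq_bigr do rewrite !inord_val).
apply: lt_le_trans; rewrite mulr_gt0 ?invr_gt0 ?exprn_gt0//.
have [i vi0] : exists i, v 0 i != 0 by apply/rV0Pn.
rewrite (bigD1 i)//= ltr_wpDr ?exprn_even_gt0//.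
by apply: sumr_ge0 => j _; exact: sqr_ge0.
Qed.

(* After step [n] all the terms of index below [2n] have their final values. *)
Fixpoint fill_even (R : realType) (f : nat -> R) (n : nat) : nat -> R :=
  if n is m.+1 then fun k =>
    if k == (2 * m)%N
    then 1 + \sum_(i < m) 2 ^+ m.+1 * fill_even R f m (m + i)%N ^+ 2
    else fill_even R f m k
  else f.

Lemma fill_even_odd (R : realType) (f : nat -> R) (n k : nat) :
  odd k -> fill_even R f n k = f k.
Proof.
move=> ok; elim: n => [//|n IHn] /=; case: eqP => // kE.
by move: ok; rewrite kE oddM.
Qed.

(** Step [n.+1] rewrites only index [2 * n], which lies beyond [k] once [m <= n]. *)
Lemma fill_even_stable (R : realType) (f : nat -> R) (m n k : nat) :
  (k < 2 * m)%N -> (m <= n)%N -> fill_even R f n k = fill_even R f m k.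
Proof.
move=> km; elim: n => [|n IHn]; first by rewrite leqn0 => /eqP ->.
rewrite leq_eqVlt => /predU1P[-> //|mn] /=.
by rewrite ifF ?IHn//; apply/eqP; lia.
Qed.

Lemma posdef_seq_odd_prescribed (R : realType) (f : nat -> R) :
  exists2 t : nat -> R, posdef_seq t & forall k, odd k -> t k = f k.
Proof.
(* Diagonal choice: [k < 2 * k.+1], so term [k] is final at stage [k.+1]. *)
exists (fun k => fill_even R f k.+1 k); last first.
  by move=> k ok; exact: fill_even_odd.
apply: posdef_seq_of_growth => n.
(* Back to stage [n.+1], where term [2 * n] was set; the terms [n + i] in its formula have index
   below [2 * n], hence are final at stage [n]. *)
rewrite (fill_even_stable _ _ n.+1) /= ?eqxx; [|lia..].
rewrite lerD2l; apply: ler_sum => i _.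
have iltn := ltn_ord i.
rewrite -/(fill_even R f (n + i).+1 (n + i)%N).
by rewrite (fill_even_stable _ _ n)//; lia.
Qed.

Theorem theorem3p5 (R : realType) (P : set nat)
    (hP : P `<=` [set (2 * k + 1)%N | k in [set: nat]]) :
  posdef_completable R P.
Proof.
move=> s sP _.
(* Unspecified odd terms get the arbitrary value 0. *)
have [t tpos tE] := posdef_seq_odd_prescribed R (fun k => odflt 0 (s k)).
exists t; split; last by left.
move=> k x skx; have /hP[m _ mk] : P k by rewrite -sP /pattern /= skx.
by rewrite tE ?skx// -mk addn1 /= oddM.
Qed.
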